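(* Let $H=\langle\eta\rangle$ be a finite submonoid of $\mathbb K^*$, let $a_1,\dots,a_r$ be integers, and let $Y_{A,H}=\{[t_1^{a_1}:\cdots:t_r^{a_r}] : t_i\in H\}\subseteq T_X$. Let $d_i=|\eta^{a_i}|$ be the order of $\eta^{a_i}$, $D=\operatorname{diag}(d_1,\dots,d_r)$, and $L_{\beta D}=\operatorname{Ker}(\beta D)\subseteq\mathbb Z^r$. Then: (a) a generating system of binomials for $I(Y_{A,H})$ is obtained from a generating system of binomials for $I_{L_{\beta D}}$ by replacing $x_i$ with $x_i^{d_i}$ for each $i$; (b) $I(Y_{A,H})$ is a complete intersection if and only if $I_{L_{\beta D}}$ is a complete intersection; (c) in that case, a minimal generating system of $I(Y_{A,H})$ is obtained from a minimal generating system of $I_{L_{\beta D}}$ by replacing $x_i$ with $x_i^{d_i}$ for each $i$.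
   Context: Setting. $X$ is a complete simplicial toric variety over a field $\mathbb K$ given by a fan $\Sigma\subset\mathbb R^n$ with rays $\rho_1,\dots,\rho_r$ and corresponding primitive lattice generators $\mathbf v_1,\dots,\mathbf v_r\in\mathbb Z^n$. The matrix $\phi:\mathbb Z^n\to\mathbb Z^r$ has rows $\mathbf v_1,\dots,\mathbf v_r$, and there is an exact sequence $0\to\mathbb Z^n\xrightarrow{\phi}\mathbb Z^r\xrightarrow{\beta}\mathcal A\to 0$ with $\mathcal A\cong \mathrm{Cl}(X)$. The Cox ring $S=\mathbb K[x_1,\dots,x_r]$ is graded by $\mathcal A$ via $\deg x_j=\beta_j:=\beta(e_j)$; ''homogeneous'' refers to this grading. Let $\mathbf u_1,\dots,\mathbf u_n\in\mathbb Z^r$ be the columns of $\phi$, write $\mathbf t^{\mathbf u}=t_1^{u_1}\cdots t_r^{u_r}$, let $\pi:(\mathbb K^* )^r\to T_X\cong(\mathbb K^* )^n$, $\pi(\mathbf t)=(\mathbf t^{\mathbf u_1},\dots,\mathbf t^{\mathbf u_n})$, and $G=\ker\pi$. The torus $T_X$ is split and $1\to G\to(\mathbb K^* )^r\xrightarrow{\pi}T_X\to1$ is assumed exact, so $T_X=(\mathbb K^* )^r/G$; the order of the torsion part of $\mathcal A$ is assumed coprime to the characteristic of $\mathbb K$. For $P=(p_1,\dots,p_r)\in(\mathbb K^* )^r$, $[P]=[p_1:\cdots:p_r]=G\cdot P$. For $Y\subseteq T_X$, $I(Y)\subseteq S$ is the ideal generated by the homogeneous polynomials vanishing on $Y$.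 A binomial is a difference $\mathbf x^{\mathbf a}-\mathbf x^{\mathbf b}$ of two monomials. For a subgroup $L\subseteq\mathbb Z^r$, writing $\mathbf m=\mathbf m^+-\mathbf m^-$ with $\mathbf m^{\pm}\in\mathbb N^r$ the positive and negative parts, the lattice ideal is $I_L=\langle \mathbf x^{\mathbf m^+}-\mathbf x^{\mathbf m^-} : \mathbf m\in L\rangle$. Here $\beta D:\mathbb Z^r\to\mathcal A$ is the composition of $D:\mathbb Z^r\to\mathbb Z^r$ with $\beta$; the paper refers to $I_{L_{\beta D}}$ as a toric ideal. An ideal is a complete intersection if it is generated by a regular sequence of homogeneous polynomials $F_1,\dots,F_k\in S$, where $k$ is the height of the ideal; for $I(Y_{A,H})$ homogeneous refers to the grading $\deg x_j=\beta_j$, and for $I_{L_{\beta D}}$ to its natural grading $\deg x_j=d_j\beta_j$. *)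

(* Defs.v *)
From HB Require Import structures.
From mathcomp Require Import all_boot all_order all_algebra.
From mathcomp Require Import mpoly.
From mathcomp Require Import boolp classical_sets functions cardinality reals.

Set Implicit Arguments.
Unset Strict Implicit.
Unset Printing Implicit Defensive.

Import Order.TTheory GRing.Theory Num.Theory.
Local Open Scope classical_set_scope.
Local Open Scope ring_scope.

Definition ideal_gen (R : comNzRingType) (G : set R) : set R :=
  [set f | exists s : seq (R * R),
     (forall cg, cg \in s -> G cg.2) /\ f = \sum_(cg <- s) cg.1 * cg.2].

Definition generating_system (R : comNzRingType) (I G : set R) : Prop :=
  ideal_gen G = I.

Definition minimal_generating_system (R : comNzRingType) (I G : set R) : Prop :=
  generating_system I G /\
  forall G' : set R, G' `<` G -> ~ generating_system I G'.

Definition regular_sequence (R : comNzRingType) (s : seq R) : Prop :=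
  ~ ideal_gen [set` s] 1 /\
  forall i, (i < size s)%N -> forall g : R,
    ideal_gen [set` take i s] (g * s`_i) -> ideal_gen [set` take i s] g.

Definition prime_ideal (R : comNzRingType) (P : set R) : Prop :=
  [/\ P 0,
      forall f g, P f -> P g -> P (f + g),
      forall c f, P f -> P (c * f),
      ~ P 1
    & forall f g, P (f * g) -> P f \/ P g].

(* There is a chain P_0 < P_1 < ... < P_k = P of primes. *)
Definition prime_height_ge (R : comNzRingType) (P : set R) (k : nat) : Prop :=
  exists C : nat -> set R,
    [/\ forall i, (i <= k)%N -> prime_ideal (C i),
        forall i, (i < k)%N -> C i `<` C i.+1
      & C k = P].

(* ht I = k, the minimum of ht P over the primes P containing I. *)
Definition ideal_height (R : comNzRingType) (I : set R) (k : nat) : Prop :=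
  (forall P, prime_ideal P -> I `<=` P -> prime_height_ge P k) /\
  (exists P, [/\ prime_ideal P, I `<=` P & ~ prime_height_ge P k.+1]).

(* Homogeneity for the grading of K[x_1..x_r] by A with deg x_j = w j;
   the zero polynomial is homogeneous. *)
Definition homogeneous (K : fieldType) (r : nat) (A : zmodType) (w : 'I_r -> A)
    (F : {mpoly K[r]}) : Prop :=
  exists alpha : A, forall m : 'X_{1..r},
    m \in msupp F -> \sum_j w j *+ m j = alpha.

Definition complete_intersection (K : fieldType) (r : nat) (A : zmodType)
    (w : 'I_r -> A) (I : set {mpoly K[r]}) : Prop :=
  exists s : seq {mpoly K[r]},
    [/\ forall F, F \in s -> homogeneous w F,
        regular_sequence s,
        generating_system I [set` s]
      & ideal_height I (size s)].

Definition is_binomial (K : fieldType) (r : nat) (F : {mpoly K[r]}) : Prop :=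
  exists a b : 'X_{1..r}, F = 'X_[a] - 'X_[b].

Definition pos_part (r : nat) (m : 'cV[int]_r) : 'X_{1..r} :=
  [multinom absz (Num.max (m i 0) 0)%R | i < r].

Definition neg_part (r : nat) (m : 'cV[int]_r) : 'X_{1..r} :=
  [multinom absz (Num.max (- m i 0) 0)%R | i < r].

Definition lattice_ideal (K : fieldType) (r : nat) (L : set 'cV[int]_r) :
    set {mpoly K[r]} :=
  ideal_gen [set 'X_[K, pos_part m] - 'X_[K, neg_part m] | m in L].

Definition subst_pow (K : fieldType) (r : nat) (d : 'I_r -> nat)
    (F : {mpoly K[r]}) : {mpoly K[r]} :=
  F \mPo [tuple 'X_i ^+ d i | i < r].

(* A cone of a fan is encoded by the set of indices of its rays, the i-th ray
   being spanned by the i-th row of phi. *)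

Definition ray_gen (R : realType) (r n : nat) (phi : 'M[int]_(r, n))
    (i : 'I_r) : 'rV[R]_n :=
  map_mx intr (row i phi).

Definition cone (R : realType) (r n : nat) (phi : 'M[int]_(r, n))
    (J : {set 'I_r}) : set 'rV[R]_n :=
  [set x | exists c : 'I_r -> R,
     (forall i, 0 <= c i) /\ x = \sum_(i in J) c i *: ray_gen R phi i].

(* The face of cone J cut out by a functional u that is nonnegative on it. *)
Definition is_face (R : realType) (r n : nat) (phi : 'M[int]_(r, n))
    (T J : {set 'I_r}) : Prop :=
  exists u : 'cV[R]_n,
    (forall i, i \in J -> 0 <= (ray_gen R phi i *m u) 0 0) /\
    T = [set i in J | (ray_gen R phi i *m u) 0 0 == 0]%SET.

Definition primitive_vector (n : nat) (v : 'rV[int]_n) : Prop :=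
  \big[gcdn/0%N]_(j < n) absz (v 0 j) = 1%N.

Definition is_fan (R : realType) (r n : nat) (phi : 'M[int]_(r, n))
    (Sigma : {set {set 'I_r}}) : Prop :=
  [/\ forall i, primitive_vector (row i phi),
      forall i, ([set i]%SET : {set 'I_r}) \in Sigma,
      forall J, J \in Sigma ->
        forall x : 'rV[R]_n, cone phi J x -> cone phi J (- x) -> x = 0,
      forall J T, J \in Sigma -> is_face R phi T J -> T \in Sigma
    & forall J J', J \in Sigma -> J' \in Sigma ->
        is_face R phi (J :&: J')%SET J /\
        cone (R := R) phi J `&` cone (R := R) phi J' = cone (R := R) phi (J :&: J')%SET].

Definition simplicial_fan (R : realType) (r n : nat) (phi : 'M[int]_(r, n))
    (Sigma : {set {set 'I_r}}) : Prop :=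
  forall J, J \in Sigma -> forall c : 'I_r -> R,
    \sum_(i in J) c i *: ray_gen R phi i = 0 -> forall i, i \in J -> c i = 0.

Definition complete_fan (R : realType) (r n : nat) (phi : 'M[int]_(r, n))
    (Sigma : {set {set 'I_r}}) : Prop :=
  forall x : 'rV[R]_n, exists2 J, J \in Sigma & cone phi J x.

Definition short_exact (r n : nat) (phi : 'M[int]_(r, n)) (A : zmodType)
    (beta : 'cV[int]_r -> A) : Prop :=
  [/\ injective (fun u : 'cV[int]_n => phi *m u),
      forall m, beta m = 0 <-> exists u : 'cV[int]_n, m = phi *m u
    & forall alpha, exists m, beta m = alpha].

Definition torsion_part (A : zmodType) : set A :=
  [set alpha | exists2 k : nat, (0 < k)%N & alpha *+ k = 0].

Definition cox_degree (r : nat) (A : zmodType) (beta : 'cV[int]_r -> A)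
    (j : 'I_r) : A :=
  beta (delta_mx j 0).

Definition L_betaD (r : nat) (A : zmodType) (beta : 'cV[int]_r -> A)
    (d : 'I_r -> nat) : set 'cV[int]_r :=
  [set m | beta (diag_mx (\row_i (d i)%:Z) *m m) = 0].

Definition torus (K : fieldType) (r : nat) : set ('I_r -> K) :=
  [set t | forall i, t i != 0].

Definition torus_map (K : fieldType) (r n : nat) (phi : 'M[int]_(r, n))
    (t : 'I_r -> K) : 'I_n -> K :=
  fun j => \prod_i t i ^ phi i j.

Definition torus_kernel (K : fieldType) (r n : nat) (phi : 'M[int]_(r, n)) :
    set ('I_r -> K) :=
  [set g | torus g /\ forall j, torus_map phi g j = 1].

(* [P] = G . P; the points of T_X are these orbits, for P in the torus. *)
Definition orbit_class (K : fieldType) (r n : nat) (phi : 'M[int]_(r, n))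
    (P : 'I_r -> K) : set ('I_r -> K) :=
  [set (fun i => g i * P i) | g in torus_kernel (K := K) phi].

(* F is evaluated at all homogeneous coordinates of the points of Y; for F
   homogeneous its vanishing does not depend on the choice of coordinates. *)
Definition vanishes_on (K : fieldType) (r : nat) (F : {mpoly K[r]})
    (Y : set (set ('I_r -> K))) : Prop :=
  forall O, Y O -> forall P, O P -> F.@[P] = 0.

Definition vanishing_ideal (K : fieldType) (r : nat) (A : zmodType)
    (w : 'I_r -> A) (Y : set (set ('I_r -> K))) : set {mpoly K[r]} :=
  ideal_gen [set F | homogeneous w F /\ vanishes_on F Y].

Definition cyclic_submonoid (K : fieldType) (eta : K) : set K :=
  range (fun k : nat => eta ^+ k).

Definition Y_AH (K : fieldType) (r n : nat) (phi : 'M[int]_(r, n))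
    (a : 'I_r -> int) (H : set K) : set (set ('I_r -> K)) :=
  [set orbit_class phi (fun i => t i ^ a i) | t in [set t | forall i, H (t i)]].

(* Main.v *)
Require Import Defs.
From HB Require Import structures.
From mathcomp Require Import all_boot all_order all_algebra.
From mathcomp Require Import mpoly ring zify.
From mathcomp Require Import boolp classical_sets functions cardinality reals.

Set Implicit Arguments.
Unset Strict Implicit.
Unset Printing Implicit Defensive.

Import Order.TTheory GRing.Theory Num.Theory.
Local Open Scope classical_set_scope.
Local Open Scope ring_scope.

(** Write [x^d] for the substitution [x_i -> x_i ^ d_i] and [sigma] for the
    endomorphism of the polynomial ring [S] that it defines. Sorting monomials by
    their exponents modulo [d] writes every [F] as a sum of [x^c * sigma F_c] over
    the residues [c]; here [F_c] is [residue_part d c F]. So [S] is a finite free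
    module over the image of [sigma], and everything follows from transporting the
    lattice ideal [I_L] along [sigma].

    The vanishing ideal [I_Y] is the extension of [I_L]
    ([vanishing_ideal_extension]). A binomial of [I_L] becomes a binomial in the
    [x_i ^ d_i] whose two exponents have the same degree, and the points of [Y]
    are in the orbit of points whose coordinates are [d_i]-th roots of unity.
    Conversely, if a homogeneous [F] vanishes on these points, then Fourier
    inversion over the group of roots of unity shows that the coefficients of each
    [F_c] add up to zero, while homogeneity puts the differences of exponents of
    [F_c] in [L]; hence [F_c] is in [I_L]. Since membership in an extended ideal
    can be read on the [F_c] and extended ideals contract back, [B] generates
    [I_L] exactly when its image generates [I_Y]; this settles (a) and (c).

    For (b), flatness makes regular sequences ascend and descend along [sigma]
    ([regular_sequence_extension]), and lying over, going down and
    incomparability keep heights ([ideal_height_extension]). What remains is to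
    find, for a homogeneous regular sequence [F_1, ..., F_k] generating [I_Y],
    such a sequence in the image of [sigma]. Replace each [F_i] by
    [sigma (F_i)_0]: the difference is a combination of elements of [I_Y] with
    coefficients in the ideal of the origin, so for degree reasons it involves only
    those [F_j] of smaller weight ([weight_part_maximal_mul]). The weights come
    from a positive relation between the rays of the complete fan
    ([complete_fan_weights]). Homogeneous regular sequences may be permuted
    ([regular_mod_perm]), so the [F_i] can be sorted by weight; then the
    replacement is unitriangular and preserves both regularity and the ideal
    ([regular_mod_map_triangular]). *)

(** * Ideals and regular sequences *)

Definition is_ideal (R : comNzRingType) (J : set R) : Prop :=
  [/\ J 0, forall f g, J f -> J g -> J (f + g) & forall c f, J f -> J (c * f)].

Definition adjoin (R : comNzRingType) (J : set R) (x : R) : set R :=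
  [set f | exists c, J (f - c * x)].

Lemma ideal_sub (R : comNzRingType) (J : set R) f g :
  is_ideal J -> J f -> J g -> J (f - g).
Proof. by case=> _ JD JM Jf Jg; rewrite -mulN1r; apply: JD (JM _ _ _). Qed.

Lemma ideal_sum (R : comNzRingType) (J : set R) I (s : seq I) (P : pred I) F :
  is_ideal J -> (forall i, P i -> J (F i)) -> J (\sum_(i <- s | P i) F i).
Proof. by case=> J0 JD JM JF; elim/big_ind: _. Qed.

Lemma ideal_sum_seq (R : comNzRingType) (J : set R) (I : eqType) (s : seq I) F :
  is_ideal J -> (forall i, i \in s -> J (F i)) -> J (\sum_(i <- s) F i).
Proof.
by move=> JI JF; rewrite big_seq; apply: ideal_sum.
Qed.

Lemma ideal_gen_ideal (R : comNzRingType) (G : set R) : is_ideal (ideal_gen G).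
Proof.
split.
- by exists [::]; split=> //; rewrite big_nil.
- move=> _ _ [s [sG ->]] [t [tG ->]]; exists (s ++ t); rewrite big_cat.
  by split=> // cg; rewrite mem_cat => /orP[/sG|/tG].
- move=> c _ [s [sG ->]]; exists [seq (c * cg.1, cg.2) | cg <- s]; split.
    by move=> _ /mapP[cg /sG Gcg ->].
  by rewrite big_map mulr_sumr; apply: eq_bigr => cg _; rewrite mulrA.
Qed.

Lemma sub_ideal_gen (R : comNzRingType) (G : set R) : G `<=` ideal_gen G.
Proof.
move=> g Gg; exists [:: (1, g)]; rewrite big_seq1 mul1r; split=> // cg.
by rewrite inE => /eqP->.
Qed.

Lemma ideal_gen_min (R : comNzRingType) (G J : set R) :
  is_ideal J -> G `<=` J -> ideal_gen G `<=` J.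
Proof.
move=> JI GJ _ [s [sG ->]]; apply: ideal_sum_seq => // cg /sG/GJ.
by case: JI => _ _; apply.
Qed.

Lemma ideal_gen_le (R : comNzRingType) (G G' : set R) :
  G `<=` G' -> ideal_gen G `<=` ideal_gen G'.
Proof.
move=> GG'; apply: ideal_gen_min; first exact: ideal_gen_ideal.
by apply: subset_trans GG' _; apply: sub_ideal_gen.
Qed.

Lemma ideal_gen_id (R : comNzRingType) (J : set R) : is_ideal J -> ideal_gen J = J.
Proof.
move=> JI; apply/seteqP; split; last exact: sub_ideal_gen.
exact: ideal_gen_min.
Qed.

Lemma adjoin_ideal (R : comNzRingType) (J : set R) x :
  is_ideal J -> is_ideal (adjoin J x).
Proof.
case=> J0 JD JM; split.
- by exists 0; rewrite mul0r subrr.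
- move=> f g [c Jf] [e Jg]; exists (c + e).
  by rewrite mulrDl opprD addrACA; apply: JD.
- by move=> c f [e Jf]; exists (c * e); rewrite -mulrA -mulrBr; apply: JM.
Qed.

Lemma sub_adjoin (R : comNzRingType) (J : set R) x : J `<=` adjoin J x.
Proof. by move=> f Jf; exists 0; rewrite mul0r subr0. Qed.

Lemma mem_adjoin (R : comNzRingType) (J : set R) x : is_ideal J -> adjoin J x x.
Proof. by case=> J0 _ _; exists 1; rewrite mul1r subrr. Qed.

Lemma ideal_gen_nil (R : comNzRingType) : ideal_gen [set` ([::] : seq R)] = [set 0].
Proof.
have JI : is_ideal [set 0 : R].
  by split=> // [f g -> ->|c f ->] /=; rewrite ?addr0 ?mulr0.
apply/seteqP; split; first by apply: ideal_gen_min.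
by move=> _ ->; case: (ideal_gen_ideal [set` ([::] : seq R)]).
Qed.

Lemma ideal_gen_rcons (R : comNzRingType) (s : seq R) x :
  ideal_gen [set` rcons s x] = adjoin (ideal_gen [set` s]) x.
Proof.
have sI := ideal_gen_ideal [set` s]; apply/seteqP; split.
  apply: ideal_gen_min; first exact: adjoin_ideal.
  move=> y /=; rewrite mem_rcons inE => /orP[/eqP->|ys]; first exact: mem_adjoin.
  by apply/sub_adjoin/sub_ideal_gen.
have [r0 rD rM] := ideal_gen_ideal [set` rcons s x].
move=> f [c sf]; rewrite -(subrK (c * x) f); apply: rD.
  by apply: ideal_gen_le sf => y /= ys; rewrite mem_rcons inE ys orbT.
by apply/rM/sub_ideal_gen; rewrite /= mem_rcons inE eqxx.
Qed.

(** Unlike the prefix ideals of [regular_sequence], the ideal [J] here changes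
    along the sequence, so the condition can be manipulated by induction on the
    sequence. *)
Fixpoint regular_mod (R : comNzRingType) (J : set R) (s : seq R) : Prop :=
  if s is x :: s' then (forall g, J (g * x) -> J g) /\ regular_mod (adjoin J x) s'
  else True.

Lemma regular_modP (R : comNzRingType) (s p : seq R) :
  (forall i, (i < size s)%N -> forall g,
     ideal_gen [set` p ++ take i s] (g * s`_i) -> ideal_gen [set` p ++ take i s] g)
  <-> regular_mod (ideal_gen [set` p]) s.
Proof.
elim: s p => [|x s IHs] p //=; rewrite -ideal_gen_rcons -IHs; split=> [reg|].
  split=> [|i lt_is]; first by have := reg 0%N erefl; rewrite cats0.
  by have := reg i.+1 lt_is; rewrite -cat_rcons.
by case=> reg0 regS [|i] lt_is; rewrite ?cats0 //= -cat_rcons; apply: regS.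
Qed.

Lemma regular_sequenceE (R : comNzRingType) (s : seq R) :
  regular_sequence s <-> ~ ideal_gen [set` s] 1 /\ regular_mod [set 0] s.
Proof. by rewrite -ideal_gen_nil -regular_modP. Qed.

(** * Finite projective ring extensions *)

(** A finite dual basis: generators [b] of [S] over [R] with linear coordinate
    forms [rho], one of which retracts [sigma]. This makes [S] a finite projective
    [R]-module that contains [R] as a direct summand, so it gives flatness in a
    form in which membership can be tested on coordinates. *)
Record projective_extension (R S : comNzRingType) (sigma : {rmorphism R -> S})
    (I : finType) (b : I -> S) (rho : I -> S -> R) (i0 : I) : Prop := ProjectiveExt {
  coord_linear : forall i f h h',
    rho i (sigma f * h + h') = f * rho i h + rho i h';
  coord_sum : forall h, h = \sum_i b i * sigma (rho i h);
  coord_retract : forall f, rho i0 (sigma f) = f }.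

Section ProjectiveExtension.
Context (R S : comNzRingType) (sigma : {rmorphism R -> S}) (I : finType)
        (b : I -> S) (rho : I -> S -> R) (i0 : I)
        (ext : projective_extension sigma b rho i0).

Lemma coord0 i : rho i 0 = 0.
Proof.
have := coord_linear ext i 0 0 0; rewrite !(mulr0, mul0r, add0r) => _.
have := coord_linear ext i (-1) 0 0; rewrite mulr0 addr0 mulN1r => ->.
by rewrite addNr.
Qed.

Lemma coordM i f h : rho i (sigma f * h) = f * rho i h.
Proof. by rewrite -[sigma f * h]addr0 (coord_linear ext) coord0 addr0. Qed.

Lemma coordD i h h' : rho i (h + h') = rho i h + rho i h'.
Proof.
by have := coord_linear ext i 1 h h'; rewrite rmorph1 !mul1r.
Qed.

Lemma preim_ideal (J : set S) : is_ideal J -> is_ideal (sigma @^-1` J).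
Proof.
case=> J0 JD JM; split=> /= [|f g|c f]; rewrite ?rmorph0 ?rmorphD ?rmorphM //.
  exact: JD.
exact: JM.
Qed.

(** The elements all of whose coordinates lie in the ideal of [B] form an ideal
    of [S], because the coordinates of a product are combinations of those of
    either factor. *)
Lemma extended_ideal_coord (B : set R) h :
  ideal_gen (sigma @` B) h <-> forall i, ideal_gen B (rho i h).
Proof.
have [B0 BD BM] := ideal_gen_ideal B.
have BsI := ideal_gen_ideal (sigma @` B); split=> [|Bh].
  suff JI : is_ideal [set h | forall i, ideal_gen B (rho i h)].
    move: h; apply: (ideal_gen_min JI) => _ [f Bf <-] i.
    rewrite -[sigma f]mulr1 coordM mulrC; apply: BM; exact: sub_ideal_gen.
  split=> /= [i|f g Bf Bg i|c f Bf i]; first by rewrite coord0.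
    by rewrite coordD; apply: BD.
  rewrite [f in c * f](coord_sum ext) mulr_sumr.
  rewrite (big_morph (rho i) (coordD i) (coord0 i)).
  apply: ideal_sum; first exact: ideal_gen_ideal.
  by move=> j _; rewrite mulrA mulrC coordM mulrC; apply: BM.
rewrite (coord_sum ext h); apply: ideal_sum => // i _.
case: (BsI) => _ _; apply.
apply: (ideal_gen_min (preim_ideal BsI)) (Bh i).
by move=> f Bf; apply: sub_ideal_gen; exists f.
Qed.

Lemma contracted_extension (B : set R) f :
  ideal_gen (sigma @` B) (sigma f) <-> ideal_gen B f.
Proof.
rewrite extended_ideal_coord; split=> [/(_ i0)|Bf i].
  by rewrite (coord_retract ext).
rewrite -[sigma f]mulr1 coordM mulrC.
by case: (ideal_gen_ideal B) => _ _; apply.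
Qed.

Lemma extension_gen (B : set R) :
  ideal_gen (sigma @` ideal_gen B) = ideal_gen (sigma @` B).
Proof.
apply/seteqP; split=> h;
by rewrite !extended_ideal_coord (ideal_gen_id (ideal_gen_ideal B)).
Qed.

(** Coordinates turn [g * sigma x] in an extended ideal into the same condition
    on each coordinate of [g]: this is flatness of [sigma], and it makes non zero
    divisors ascend.  They descend because [sigma] is split. *)
Lemma nonzerodivisor_extension (B : set R) x :
  (forall g, ideal_gen B (g * x) -> ideal_gen B g) <->
  (forall g, ideal_gen (sigma @` B) (g * sigma x) -> ideal_gen (sigma @` B) g).
Proof.
split=> reg g.
  rewrite !extended_ideal_coord => Bg i; apply: reg.
  by rewrite mulrC -coordM mulrC.
by rewrite -2!contracted_extension rmorphM; apply: reg.
Qed.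

Lemma set_map_image (s : seq R) : [set` map sigma s] = sigma @` [set` s].
Proof.
by apply/seteqP; split=> [_ /mapP[f fs ->]|_ [f fs <-]] /=; [exists f|apply: map_f].
Qed.

Lemma regular_sequence_extension (s : seq R) :
  regular_sequence s <-> regular_sequence (map sigma s).
Proof.
rewrite /regular_sequence -(rmorph1 sigma) set_map_image contracted_extension.
split=> -[ns reg]; split=> // i lt_i.
  rewrite size_map in lt_i; rewrite -map_take set_map_image (nth_map 0) //.
  exact/(nonzerodivisor_extension _ _).1/reg.
apply/nonzerodivisor_extension; rewrite -set_map_image map_take -(nth_map 0 0) //.
by apply: reg; rewrite size_map.
Qed.
End ProjectiveExtension.

(** * Primes and heights in projective integral extensions *)

Lemma prime_is_ideal (R : comNzRingType) (P : set R) : prime_ideal P -> is_ideal P.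
Proof. by case=> P0 PD PM _ _. Qed.

(** Krull's lemma: an ideal maximal among those avoiding a multiplicative set is
    prime. *)
Lemma prime_avoiding (R : comNzRingType) (J U : set R) :
  is_ideal J -> U 1 -> (forall u v, U u -> U v -> U (u * v)) ->
  (forall f, J f -> ~ U f) ->
  exists P, [/\ prime_ideal P, J `<=` P & forall f, P f -> ~ U f].
Proof.
move=> JI U1 UM JU; have [J0 JD JM] := JI.
(* Adding [J] to the union lets the empty chain be admissible. *)
pose good X := is_ideal (X `|` J) /\ forall f, (X `|` J) f -> ~ U f.
have [|A [[AI AU] maxA]] := @Zorn_bigcup R good.
  move=> F Fgood Ftot; have FU f : (\bigcup_(X in F) X `|` J) f -> ~ U f.
    case=> [[X FX Xf]|/JU//]; have [_ XU] := Fgood X FX.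
    by apply: XU; left.
  split=> //; split; first by right.
    have lift X f g : F X -> (X `|` J) f -> (X `|` J) g ->
        (\bigcup_(X in F) X `|` J) (f + g).
      move=> FX Xf Xg; have [[_ XD _] _] := Fgood X FX.
      by case: (XD f g Xf Xg); [left; exists X|right].
    move=> f g [[X FX Xf]|Jf] [[Y FY Yg]|Jg]; last by right; apply: JD.
    - case: (Ftot X Y FX FY) => XY.
        by apply: (lift Y) => //; left=> //; apply: XY.
      by apply: (lift X) => //; left=> //; apply: XY.
    - by apply: (lift X) => //; [left|right].
    - by apply: (lift Y) => //; [right|left].
  move=> c f [[X FX Xf]|Jf]; last by right; apply: JM.
  have [[_ _ XM] _] := Fgood X FX.
  by case: (XM c f (or_introl Xf)); [left; exists X|right].
set P := A `|` J in AI AU; have [P0 PD PM] := AI.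
have meetU f : ~ P f -> exists2 u, U u & adjoin P f u.
  move=> nPf; apply: contrapT => nU.
  have QI := adjoin_ideal f AI.
  have QE : adjoin P f `|` J = adjoin P f.
    apply/setUidPl => g Jg; apply: sub_adjoin; by right.
  apply: (maxA (adjoin P f)).
    split; first by move=> g Ag; apply: sub_adjoin; left.
    by move=> /(_ f (mem_adjoin _ AI)) Af; apply: nPf; left.
  by split; rewrite QE // => g Qg Ug; apply: nU; exists g.
exists P; split=> //; last by move=> f Jf; right.
split=> // [P1|f g Pfg]; first exact: AU P1 U1.
apply: contrapT => /not_orP[/meetU[u Uu [c Pu]] /meetU[v Uv [e Pv]]].
apply: (AU (u * v)); last exact: UM.
have -> : u * v = v * (u - c * f) + c * f * (v - e * g) + (c * e) * (f * g) by ring.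
by apply: (PD); [apply: (PD)|]; apply: PM.
Qed.

Section Primes.
Context (R S : comNzRingType) (sigma : {rmorphism R -> S}) (I : finType)
        (b : I -> S) (rho : I -> S -> R) (i0 : I)
        (ext : projective_extension sigma b rho i0)
        (sigma_int : forall h, integralOver sigma h).

Lemma preim_prime (P : set S) : prime_ideal P -> prime_ideal (sigma @^-1` P).
Proof.
move=> Pp; have [Q0 QD QM] := preim_ideal sigma (prime_is_ideal Pp).
case: Pp => _ _ _ P1 Pm; split=> //=; first by rewrite rmorph1.
by move=> f g; rewrite rmorphM; apply: Pm.
Qed.

(** An element outside [Q] is a non zero divisor modulo the extension of [Q], by
    flatness; so products of such elements with members of [U] still avoid that
    extension. *)
Lemma prime_over_avoiding (Q : set R) (U : set S) :
  prime_ideal Q -> U 1 -> (forall u v, U u -> U v -> U (u * v)) ->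
  (forall h, ideal_gen (sigma @` Q) h -> ~ U h) ->
  exists P, [/\ prime_ideal P, sigma @^-1` P = Q & forall h, P h -> ~ U h].
Proof.
move=> Qp U1 UM QU; have QI := prime_is_ideal Qp; have [_ _ _ Q1 Qm] := Qp.
pose V := [set h | exists s u, [/\ ~ Q s, U u & h = sigma s * u]].
have [||||P [Pp QP PV]] := @prime_avoiding S (ideal_gen (sigma @` Q)) V.
- exact: ideal_gen_ideal.
- by exists 1, 1; split; rewrite ?rmorph1 ?mulr1.
- move=> _ _ [s [u [Qs Uu ->]]] [t [v [Qt Uv ->]]]; exists (s * t), (u * v).
  by split; [move=> /Qm[]|apply: UM|rewrite rmorphM mulrACA].
- move=> h + [s [u [Qs Uu hE]]]; rewrite hE mulrC => Qsu; apply: (QU u) => //.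
  apply: (nonzerodivisor_extension ext Q s).1 Qsu => g.
  by rewrite ideal_gen_id // => /Qm[].
exists P; split=> //; last first.
  by move=> h Ph Uh; apply: (PV h Ph); exists 1, h; split; rewrite ?rmorph1 ?mul1r.
apply/seteqP; split=> f /= Pf; last by apply/QP/sub_ideal_gen; exists f.
apply: contrapT => Qf; apply: (PV _ Pf).
by exists f, 1; split; rewrite ?mulr1.
Qed.

Lemma lying_over (Q : set R) : prime_ideal Q ->
  exists2 P, prime_ideal P & sigma @^-1` P = Q.
Proof.
move=> Qp; have [||h Qh h1|P [Pp PQ _]] := @prime_over_avoiding Q [set 1] Qp.
- by [].
- by move=> u v -> ->; rewrite /= mulr1.
- have [_ _ _ Q1 _] := Qp; apply: Q1; move: Qh; rewrite h1 -(rmorph1 sigma).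
  by rewrite (contracted_extension ext) ideal_gen_id //; apply: prime_is_ideal.
by exists P.
Qed.

Lemma going_down (P : set S) (Q : set R) :
  prime_ideal P -> prime_ideal Q -> Q `<=` sigma @^-1` P ->
  exists P', [/\ prime_ideal P', P' `<=` P & sigma @^-1` P' = Q].
Proof.
move=> Pp Qp QP; have [P0 PD PM P1 Pm] := Pp.
have [||h Qh|P' [Pp' PQ' P'P]] := @prime_over_avoiding Q (~` P) Qp.
- by [].
- by move=> u v Pu Pv /Pm[].
- apply; have PI := prime_is_ideal Pp.
  by apply: (ideal_gen_min PI) Qh => _ [f Qf <-]; apply: QP.
by exists P'; split=> // h /P'P/contrapT.
Qed.

(** Take [h] in [P1] but not in [P] and a monic equation of least degree
    satisfied by [h] modulo [P]: its constant term lies in [P1], hence in [P], and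
    [h] can be cancelled. *)
Lemma incomparability (P P1 : set S) :
  prime_ideal P -> prime_ideal P1 -> P `<=` P1 ->
  sigma @^-1` P1 `<=` sigma @^-1` P -> P1 `<=` P.
Proof.
move=> Pp Pp1 PP1 le1 h P1h; apply: contrapT => Ph.
have PI := prime_is_ideal Pp; have P1I := prime_is_ideal Pp1.
have [_ _ _ P1n Pm] := Pp; have [_ _ P1M _ _] := Pp1.
have [p mon_p /rootP ph0] := sigma_int h.
have : P (map_poly sigma p).[h] by rewrite ph0; case: PI.
elim/poly_ind: p mon_p {ph0} => [/monic_neq0/eqP//|p c IHp mon_p].
have [p0|p0] := eqVneq p 0.
  move: mon_p; rewrite p0 mul0r add0r => /monicP; rewrite lead_coefC => ->.
  by rewrite map_polyC /= hornerC rmorph1.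
have mon_p' : p \is monic.
  move: mon_p; rewrite !monicE lead_coefDl ?lead_coefMX //.
  by rewrite size_mulX // ltnS (leq_trans (size_polyC_leq1 _)) // size_poly_gt0.
rewrite rmorphD rmorphM /= map_polyX map_polyC /= !hornerE => Pp'.
have Pc : P (sigma c).
  apply: le1 => /=; set y := _ * h in Pp'.
  rewrite -(addKr y (sigma c)) addrC; apply: ideal_sub => //; first exact: PP1.
  exact: P1M.
have : P ((map_poly sigma p).[h] * h).
  by rewrite -(addrK (sigma c) (_ * h)); apply: ideal_sub.
by move=> /Pm[/(IHp mon_p')|].
Qed.

(** Chains of primes contract to strict chains by incomparability, and lift from
    the top by going down. *)
Lemma prime_height_contraction (P : set S) k : prime_ideal P ->
  prime_height_ge P k <-> prime_height_ge (sigma @^-1` P) k.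
Proof.
move=> Pp; split=> [[C [Cp Cl Ck]]|].
  exists (fun i => sigma @^-1` C i); split=> [i le_ik|i lt_ik|]; last by rewrite Ck.
    exact/preim_prime/Cp.
  have [leC nleC] := Cl i lt_ik; split; first by move=> f /leC.
  move=> le1; apply: nleC; apply: incomparability le1 => //; apply: Cp => //.
  exact: ltnW.
elim: k P Pp => [|k IHk] P Pp [C [Cp Cl Ck]].
  by exists (fun=> P); split=> // i; rewrite ltn0.
have CkP : C k `<` sigma @^-1` P by rewrite -Ck; apply: Cl.
have [P' [Pp' leP' P'Q]] := going_down Pp (Cp k (leqnSn k)) (properW CkP).
have [|C' [C'p C'l C'k]] := IHk P' Pp'.
  by exists C; split=> // i lti; [apply/Cp/leqW|apply/Cl/leqW].
exists (fun i => if (i <= k)%N then C' i else P); split=> [i _|i|].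
- by case: ifP => // /C'p.
- rewrite ltnS => le_ik; rewrite le_ik; case: ltnP => [|ge_ik]; first exact: C'l.
  have -> : i = k by apply/eqP; rewrite eqn_leq le_ik.
  rewrite C'k; split=> // PP'; case: CkP => _; apply.
  by rewrite -P'Q => f; apply: PP'.
- by rewrite ltnn.
Qed.

(** Primes over the extended ideal contract to primes over [J], all of these
    arise, and contraction keeps heights. *)
Lemma ideal_height_extension (J : set R) k :
  ideal_height J k <-> ideal_height (ideal_gen (sigma @` J)) k.
Proof.
have over P : prime_ideal P ->
    ideal_gen (sigma @` J) `<=` P <-> J `<=` sigma @^-1` P.
  move=> /prime_is_ideal PI; split=> [leP f Jf|leJ].
    by apply/leP/sub_ideal_gen; exists f.
  by apply: ideal_gen_min => // _ [f Jf <-]; apply: leJ.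
split=> -[ge_k [Q [Qp JQ ltQ]]]; split.
- move=> P Pp /(over P Pp) JP; rewrite prime_height_contraction //.
  exact/ge_k/JP/preim_prime.
- have [P Pp PQ] := lying_over Qp; exists P.
  by split; rewrite ?over ?prime_height_contraction // PQ.
- move=> P Pp JP; have [P' Pp' PQ] := lying_over Pp.
  rewrite -PQ -prime_height_contraction //.
  by apply: ge_k; rewrite // over // PQ.
- exists (sigma @^-1` Q); split; rewrite -?over -?prime_height_contraction //.
  exact: preim_prime.
Qed.
End Primes.

(** * Extending maps linearly from monomials *)

Definition monomial_linear (K : fieldType) (r : nat)
    (phi : 'X_{1..r} -> {mpoly K[r]}) (F : {mpoly K[r]}) : {mpoly K[r]} :=
  \sum_(m <- msupp F) F@_m *: phi m.

Lemma monomial_linearE (K : fieldType) (r : nat)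
    (phi : 'X_{1..r} -> {mpoly K[r]}) (F : {mpoly K[r]}) (s : seq 'X_{1..r}) :
  uniq s -> {subset msupp F <= s} ->
  monomial_linear phi F = \sum_(m <- s) F@_m *: phi m.
Proof.
move=> s_uniq Fs; rewrite (bigID (mem (msupp F))) /= [X in _ + X]big1 ?addr0; last first.
  by move=> m Fm; rewrite (memN_msupp_eq0 Fm) scale0r.
rewrite -big_filter /monomial_linear; apply/perm_big/uniq_perm; rewrite ?filter_uniq //.
by move=> m; rewrite mem_filter andbC; case: (boolP (m \in msupp F)) => [/Fs->|]; rewrite ?andbF.
Qed.

Lemma monomial_linear_is_linear (K : fieldType) (r : nat)
  (phi : 'X_{1..r} -> {mpoly K[r]}) : linear (monomial_linear phi).
Proof.
move=> a F G; pose s := undup (msupp (a *: F + G) ++ msupp F ++ msupp G).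
rewrite !(@monomial_linearE _ _ _ _ s) ?undup_uniq //; first last.
- by move=> m; rewrite mem_undup !mem_cat => ->; rewrite ?orbT.
- by move=> m; rewrite mem_undup !mem_cat => ->; rewrite ?orbT.
- by move=> m; rewrite mem_undup !mem_cat => ->; rewrite ?orbT.
rewrite scaler_sumr -big_split; apply: eq_bigr => m _ /=.
by rewrite mcoeffD mcoeffZ scalerDl scalerA.
Qed.

HB.instance Definition _ (K : fieldType) (r : nat) phi :=
  GRing.isLinear.Build K _ _ _ (@monomial_linear K r phi)
    (@monomial_linear_is_linear K r phi).

Lemma monomial_linearX (K : fieldType) (r : nat)
  (phi : 'X_{1..r} -> {mpoly K[r]}) m : monomial_linear phi 'X_[m] = phi m.
Proof. by rewrite /monomial_linear msuppX big_seq1 mcoeffX eqxx scale1r. Qed.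

(** * The polynomial ring over its subring of [d]-th powers *)

HB.instance Definition _ (K : fieldType) (r : nat) (d : 'I_r -> nat) :=
  GRing.LRMorphism.copy (@subst_pow K r d)
    (fun F => F \mPo [tuple 'X_i ^+ d i | i < r]).

Definition mnm_mul (r : nat) (d : 'I_r -> nat) (m : 'X_{1..r}) : 'X_{1..r} :=
  [multinom (d i * m i)%N | i < r].
Definition mnm_div (r : nat) (d : 'I_r -> nat) (m : 'X_{1..r}) : 'X_{1..r} :=
  [multinom (m i %/ d i)%N | i < r].
Definition mnm_mod (r : nat) (d : 'I_r -> nat) (m : 'X_{1..r}) : 'X_{1..r} :=
  [multinom (m i %% d i)%N | i < r].

(** The coordinate at ['X_[c]] over the subring of [d]-th powers, read back as a
    polynomial in the ['X_i] themselves. *)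
Definition residue_part (K : fieldType) (r : nat) (d : 'I_r -> nat)
    (c : 'X_{1..r}) : {mpoly K[r]} -> {mpoly K[r]} :=
  monomial_linear (fun m => if mnm_mod d m == c then 'X_[mnm_div d m] else 0).

HB.instance Definition _ (K : fieldType) (r : nat) d c :=
  GRing.Linear.copy (@residue_part K r d c) (monomial_linear
    (fun m => if mnm_mod d m == c then 'X_[mnm_div d m] else 0)).

Lemma residue_partX (K : fieldType) (r : nat) (d : 'I_r -> nat) c m :
  residue_part d c 'X_[K, m] = if mnm_mod d m == c then 'X_[mnm_div d m] else 0.
Proof. exact: monomial_linearX. Qed.

Lemma subst_powX (K : fieldType) (r : nat) (d : 'I_r -> nat) m :
  subst_pow d 'X_[K, m] = 'X_[mnm_mul d m].
Proof.
rewrite /subst_pow comp_mpolyX [RHS]mpolyXE_id; apply: eq_bigr => i _.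
by rewrite tnth_mktuple mnmE -exprM.
Qed.

Lemma mnm_mod_mulD (r : nat) (d : 'I_r -> nat) (m k : 'X_{1..r}) :
  mnm_mod d (mnm_mul d m + k)%MM = mnm_mod d k.
Proof. by apply/mnmP=> i; rewrite !mnmE mulnC modnMDl. Qed.

Lemma mnm_div_mulD (r : nat) (d : 'I_r -> nat) (m k : 'X_{1..r}) :
  (forall i, 0 < d i)%N -> mnm_div d (mnm_mul d m + k)%MM = (m + mnm_div d k)%MM.
Proof. by move=> d_gt0; apply/mnmP=> i; rewrite !mnmE mulnC divnMDl. Qed.

Lemma mnm_divE (r : nat) (d : 'I_r -> nat) (m : 'X_{1..r}) :
  m = (mnm_mod d m + mnm_mul d (mnm_div d m))%MM.
Proof. by apply/mnmP=> i; rewrite !mnmE mulnC addnC -divn_eq. Qed.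

Lemma mnm_mul_inj (r : nat) (d : 'I_r -> nat) :
  (forall i, 0 < d i)%N -> injective (mnm_mul d).
Proof.
move=> d_gt0 m k /mnmP eq_mk; apply/mnmP=> i; have := eq_mk i; rewrite !mnmE.
by move/eqP; rewrite eqn_pmul2l // => /eqP.
Qed.

(** Residues modulo [d] have bounded degree, which makes the monomial basis a
    finite type. *)
Lemma mdeg_mnm_mod (r : nat) (d : 'I_r -> nat) (m : 'X_{1..r}) :
  (forall i, 0 < d i)%N -> (mdeg (mnm_mod d m) < (\sum_i d i).+1)%N.
Proof.
move=> d_gt0; rewrite ltnS mdegE; apply: leq_sum => i _.
by rewrite mnmE ltnW // ltn_mod.
Qed.

Lemma mdeg0_bound (r N : nat) : (mdeg (0%MM : 'X_{1..r}) < N.+1)%N.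
Proof. by rewrite mdeg0. Qed.

Section SubstPow.
Context (K : fieldType) (r : nat) (d : 'I_r -> nat) (d_gt0 : forall i, (0 < d i)%N).
Implicit Types f g F h : {mpoly K[r]}.

Lemma residue_partM c f h :
  residue_part d c (subst_pow d f * h) = f * residue_part d c h.
Proof.
elim/mpolyind: f => [|a m f _ _ IHf]; first by rewrite linear0 !mul0r linear0.
rewrite linearD linearZ /= !mulrDl -!scalerAl linearD linearZ /= IHf; congr (_ *: _ + _).
elim/mpolyind: h {f IHf} => [|e k h _ _ IHh]; first by rewrite !linear0 !mulr0 linear0.
rewrite !mulrDr !linearD /= mulrDr IHh -!scalerAr !linearZ /= -scalerAr; congr (_ *: _ + _).
rewrite subst_powX -mpolyXD !residue_partX mnm_mod_mulD mnm_div_mulD //.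
by case: eqP => _; rewrite ?mulr0 // mpolyXD.
Qed.

Lemma residue_part_sum h :
  h = \sum_(c : 'X_{1..r < (\sum_i d i).+1}) 'X_[c] * subst_pow d (residue_part d c h).
Proof.
elim/mpolyind: h => [|a m h _ _ IHh].
  by rewrite big1 // => c _; rewrite linear0 linear0 mulr0.
rewrite (eq_bigr (fun c : 'X_{1..r < (\sum_i d i).+1} =>
    'X_[c] * subst_pow d (residue_part d c (a *: 'X_[m]))
    + 'X_[c] * subst_pow d (residue_part d c h))); last first.
  by move=> c _; rewrite linearD linearD mulrDr.
rewrite big_split -IHh /=; congr (_ + _).
rewrite (bigD1 (BMultinom (mdeg_mnm_mod m d_gt0))) //= big1 ?addr0.
  rewrite !linearZ /= residue_partX eqxx subst_powX -scalerAr -mpolyXD.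
  by rewrite -mnm_divE.
move=> c c_neq; rewrite !linearZ /= residue_partX ifN ?linear0 ?scaler0 ?mulr0 //.
by apply: contra c_neq => /eqP c_eq; apply/eqP/val_inj.
Qed.

Lemma residue_part0K f : residue_part d 0%MM (subst_pow d f) = f.
Proof.
rewrite -[subst_pow d f]mulr1 residue_partM -mpolyX0 residue_partX.
have [-> ->] : mnm_mod d 0 = 0%MM /\ mnm_div d 0 = 0%MM.
  by split; apply/mnmP=> i; rewrite !mnmE ?mod0n ?div0n.
by rewrite eqxx mpolyX0 mulr1.
Qed.

Lemma subst_pow_projective : projective_extension (@subst_pow K r d)
  (fun c : 'X_{1..r < (\sum_i d i).+1} => 'X_[c]) (fun c => residue_part d c)
  (BMultinom (mdeg0_bound r (\sum_i d i))).
Proof.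
split=> [c f h h'|h|f]; last exact: residue_part0K.
  by rewrite linearD /= residue_partM.
exact: residue_part_sum.
Qed.

(** ['X_i] is a root of [T ^+ d i - sigma 'X_i]. *)
Lemma subst_pow_integral h : integralOver (@subst_pow K r d) h.
Proof.
have intC c : integralOver (@subst_pow K r d) c%:MP.
  have <- : subst_pow d c%:MP = c%:MP by rewrite /subst_pow comp_mpolyC.
  exact: integral_id.
have intX i : integralOver (@subst_pow K r d) 'X_i.
  exists ('X^(d i) - ('X_i)%:P); first exact: monicXnsubC.
  rewrite rmorphB /= map_polyXn map_polyC rootE !hornerE /= subst_powX.
  have -> : mnm_mul d U_(i) = (U_(i) *+ d i)%MM.
    apply/mnmP=> j; rewrite !mnmE mulmnE mnm1E mulnC.
    by case: (eqVneq i j) => [->|_]; rewrite ?mul0n.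
  by rewrite mpolyXn subrr.
elim/mpolyind: h => [|c m h _ _ IHh]; first by rewrite -mpolyC0; apply: intC.
apply: integral_add IHh; rewrite -mul_mpolyC; apply: integral_mul (intC c) _.
rewrite mpolyXE_id; elim/big_ind: _ => [||i _]; first by rewrite -mpolyC1.
  exact: integral_mul.
elim: (m i) => [|k IHk]; first by rewrite expr0 -mpolyC1.
by rewrite exprS; apply: integral_mul.
Qed.

Lemma msupp_subst_pow f m :
  m \in msupp (subst_pow d f) -> exists2 k, k \in msupp f & m = mnm_mul d k.
Proof.
rewrite {1}(mpolyE f) linear_sum => /msupp_sum_le/flatten_mapP[k].
rewrite filter_predT => fk; rewrite linearZ /= subst_powX => /msuppZ_le.
by rewrite msuppX inE => /eqP->; exists k.
Qed.

Lemma mcoeff_residue_part0 F m : (residue_part d 0%MM F)@_m = F@_(mnm_mul d m).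
Proof.
elim/mpolyind: F => [|a k f _ _ IHf]; first by rewrite linear0 !mcoeff0.
rewrite linearD linearZ /= !mcoeffD !mcoeffZ IHf residue_partX; congr (_ * _ + _).
rewrite mcoeffX; case: eqP => [k0|k_neq].
  rewrite mcoeffX {2}[k](mnm_divE d) k0 add0m.
  by rewrite (inj_eq (mnm_mul_inj d_gt0)).
rewrite mcoeff0; case: eqP => // km; case: k_neq; rewrite km.
by apply/mnmP=> i; rewrite !mnmE mulnC modnMl.
Qed.
End SubstPow.

(** * Homogeneous regular sequences for a positive grading *)

Definition mnm_weight (R : realType) (r : nat) (w : 'I_r -> R) (m : 'X_{1..r}) : R :=
  \sum_j w j * (m j)%:R.

Definition weight_part (R : realType) (K : fieldType) (r : nat) (w : 'I_r -> R)
    (t : R) : {mpoly K[r]} -> {mpoly K[r]} :=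
  monomial_linear (fun m => if mnm_weight w m == t then 'X_[m] else 0).

HB.instance Definition _ (R : realType) (K : fieldType) (r : nat) w t :=
  GRing.Linear.copy (@weight_part R K r w t)
    (monomial_linear (fun m => if mnm_weight w m == t then 'X_[m] else 0)).

(** All monomials of a homogeneous polynomial have the same weight, so the first
    one decides. *)
Definition weight (R : realType) (K : fieldType) (r : nat) (w : 'I_r -> R)
    (F : {mpoly K[r]}) : R :=
  mnm_weight w (head 0%MM (msupp F)).

Definition weight_homogeneous (R : realType) (K : fieldType) (r : nat)
    (w : 'I_r -> R) (F : {mpoly K[r]}) : Prop :=
  weight_part w (weight w F) F = F.

Definition graded_ideal (R : realType) (K : fieldType) (r : nat)
    (w : 'I_r -> R) (J : set {mpoly K[r]}) : Prop :=
  is_ideal J /\ forall t F, J F -> J (weight_part w t F).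

(** Each element changes by a combination of the preceding ones, which alters
    neither the prefix ideals nor multiplication modulo them. *)
Lemma regular_mod_map_triangular (R : comNzRingType) (f : R -> R) (J : set R) (s : seq R) :
  is_ideal J ->
  (forall p x q, s = p ++ x :: q -> foldl (@adjoin R) J p (x - f x)) ->
  regular_mod J s ->
  regular_mod J (map f s) /\ foldl (@adjoin R) J (map f s) = foldl (@adjoin R) J s.
Proof.
elim: s J => [|x s IHs] J JI //= tri [regx regs].
have Jfx : J (x - f x) by apply: (tri [::]).
have [_ JD JM] := JI.
have adjE : adjoin J (f x) = adjoin J x.
  apply/seteqP; split=> g [c Jg]; exists c.
    have -> : g - c * x = g - c * f x - c * (x - f x) by ring.
    by apply: ideal_sub => //; apply: JM.
  have -> : g - c * f x = g - c * x + c * (x - f x) by ring.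
  by apply: (JD) => //; apply: JM.
have [|regfs foldE] := IHs _ (adjoin_ideal x JI) _ regs.
  by move=> p y q sE; apply: (tri (x :: p) y q); rewrite sE.
rewrite adjE; split=> //; split=> // g Jg; apply: regx.
have -> : g * x = g * f x + g * (x - f x) by ring.
by apply: (JD) => //; apply: JM.
Qed.

Lemma foldl_adjoin_gen (R : comNzRingType) (s : seq R) :
  foldl (@adjoin R) [set 0] s = ideal_gen [set` s].
Proof.
elim/last_ind: s => [|s x IHs]; first by rewrite ideal_gen_nil.
by rewrite -cats1 foldl_cat /= IHs cats1 ideal_gen_rcons.
Qed.

Lemma adjoinC (R : comNzRingType) (J : set R) x y :
  adjoin (adjoin J x) y = adjoin (adjoin J y) x.
Proof.
by apply/seteqP; split=> f [c [e Jf]]; exists e, c; rewrite addrAC.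
Qed.

Section Graded.
Context (R : realType) (K : fieldType) (r : nat) (w : 'I_r -> R).
Context (w_ge1 : forall j, 1 <= w j).
Implicit Types (F G : {mpoly K[r]}) (J : set {mpoly K[r]}).

Lemma mnm_weightD m k :
  mnm_weight w (m + k)%MM = mnm_weight w m + mnm_weight w k.
Proof.
rewrite -big_split; apply: eq_bigr => j _.
by rewrite mnmE natrD mulrDr.
Qed.

Lemma mnm_weight_ge0 m : 0 <= mnm_weight w m.
Proof. by apply: sumr_ge0 => j _; rewrite mulr_ge0 // (le_trans ler01). Qed.

Lemma mnm_weight_eq0 m : mnm_weight w m = 0 -> m = 0%MM.
Proof.
move=> m0; apply/mnmP=> i; rewrite mnm0E; apply/eqP; rewrite -(pnatr_eq0 R).
have /psumr_eq0P/(_ i isT)/eqP := m0.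
rewrite mulf_eq0 gt_eqF ?(lt_le_trans ltr01) //=; apply=> j _.
by rewrite mulr_ge0 // (le_trans ler01).
Qed.

Lemma weight_partX t m :
  weight_part w t 'X_[K, m] = if mnm_weight w m == t then 'X_[m] else 0.
Proof. exact: monomial_linearX. Qed.

Lemma mcoeff_weight_part t F m :
  (weight_part w t F)@_m = F@_m *+ (mnm_weight w m == t).
Proof.
elim/mpolyind: F => [|a k F _ _ IHF]; first by rewrite linear0 !mcoeff0 mul0rn.
rewrite linearD linearZ /= !mcoeffD !mcoeffZ IHF mulrnDl; congr (_ + _).
rewrite weight_partX mcoeffX; case: (eqVneq k m) => [->|km].
  by case: eqP; rewrite ?mcoeffX ?eqxx ?mcoeff0 ?mulr0.
rewrite mulr0 mul0rn; case: eqP => _; rewrite ?mcoeff0 ?mulr0 //.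
by rewrite mcoeffX (negbTE km) mulr0.
Qed.

Lemma weight_part_id t F : weight_part w t (weight_part w t F) = weight_part w t F.
Proof. by apply/mpolyP=> m; rewrite !mcoeff_weight_part; case: eqP. Qed.

Lemma weight_part_neg t F : t < 0 -> weight_part w t F = 0.
Proof.
move=> t_lt0; apply/mpolyP=> m; rewrite mcoeff_weight_part mcoeff0.
by rewrite gt_eqF // (lt_le_trans t_lt0) // mnm_weight_ge0.
Qed.

Lemma weight_part0 F : weight_part w 0 F = (F@_0%MM)%:MP.
Proof.
apply/mpolyP=> m; rewrite mcoeff_weight_part mcoeffC.
have [->|m0] := eqVneq m 0%MM.
  rewrite mulr1; suff -> : mnm_weight w 0%MM = 0 by rewrite eqxx.
  by rewrite /mnm_weight big1 // => j _; rewrite mnm0E mulr0.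
rewrite mulr0; case: eqP => // /mnm_weight_eq0 mE.
by rewrite mE eqxx in m0.
Qed.

Lemma weight_homogeneousP t F :
  (forall m, m \in msupp F -> mnm_weight w m = t) ->
  weight_homogeneous w F.
Proof.
move=> Ft; apply/mpolyP=> m; rewrite mcoeff_weight_part.
have [mF|mF] := boolP (m \in msupp F); last by rewrite memN_msupp_eq0 // mul0rn.
suff -> : weight w F = t by rewrite (Ft m mF) eqxx.
rewrite /weight; case: (msupp F) Ft mF => //= k s Ft _.
by apply: Ft; rewrite inE eqxx.
Qed.

Lemma weight_partM t u F G :
  weight_part w t (G * weight_part w u F) = weight_part w (t - u) G * weight_part w u F.
Proof.
elim/mpolyind: F => [|a m F _ _ IHF]; first by rewrite linear0 !mulr0 linear0.
have -> : weight_part w u (a *: 'X_[m] + F)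
    = a *: weight_part w u 'X_[m] + weight_part w u F by rewrite linearD linearZ.
rewrite !mulrDr linearD /= IHF; congr (_ + _).
rewrite -!scalerAr linearZ /=; congr (_ *: _) => {a F IHF}.
rewrite weight_partX; case: eqP => mu; last by rewrite !mulr0 linear0.
elim/mpolyind: G => [|a k G _ _ IHG]; first by rewrite linear0 !mul0r linear0.
rewrite !mulrDl !linearD /= mulrDl IHG -!scalerAl !linearZ /= -scalerAl.
congr (_ *: _ + _); rewrite -mpolyXD !weight_partX mnm_weightD mu.
rewrite -{1}(subrK u t) (inj_eq (addIr u)).
by case: ifP; rewrite ?mul0r // mpolyXD.
Qed.

Lemma weight_part_mul t F G : weight_homogeneous w F ->
  weight_part w t (G * F) = weight_part w (t - weight w F) G * F.
Proof. by move=> homF; rewrite -homF weight_partM homF. Qed.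

Lemma weight_part_sum F :
  F = \sum_(t <- undup (map (mnm_weight w) (msupp F))) weight_part w t F.
Proof.
apply/mpolyP=> m; rewrite linear_sum /=.
under eq_bigr do rewrite mcoeff_weight_part.
have [mF|mF] := boolP (m \in msupp F); last first.
  by rewrite big1 // => [|t _]; rewrite memN_msupp_eq0 // mul0rn.
rewrite (bigD1_seq (mnm_weight w m)) ?undup_uniq ?mem_undup ?map_f //=.
rewrite eqxx big1 ?addr0 // => t /negbTE; by rewrite eq_sym => ->.
Qed.

(** Together with [graded_ideal], this lets membership be tested one weight at a
    time. *)
Lemma mem_weight_part J F :
  is_ideal J -> (forall t, J (weight_part w t F)) -> J F.
Proof. by move=> JI JF; rewrite (weight_part_sum F); apply: ideal_sum. Qed.

Lemma adjoin_graded J F :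
  graded_ideal w J -> weight_homogeneous w F -> graded_ideal w (adjoin J F).
Proof.
case=> JI Jgr homF; split; first exact: adjoin_ideal.
move=> t G [c /(Jgr t) JG]; exists (weight_part w (t - weight w F) c).
by rewrite -weight_part_mul // -linearB.
Qed.

(** The elements killed by [G] modulo [J] form a submodule [N] with [N = F N],
    and a nonzero homogeneous element cannot be divided for ever by an element of
    positive weight. *)
Lemma regular_swap J F G : graded_ideal w J ->
  weight_homogeneous w F -> 0 < weight w F -> weight_homogeneous w G ->
  (forall g, J (g * F) -> J g) ->
  (forall g, adjoin J F (g * G) -> adjoin J F g) ->
  (forall g, J (g * G) -> J g) /\ (forall g, adjoin J G (g * F) -> adjoin J G g).
Proof.
move=> [JI Jgr] homF F_gt0 homG regF regG.
have regJ g : J (g * G) -> J g.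
  move=> JgG; apply: mem_weight_part => // t.
  (* Each division by [F] lowers the weight by [weight w F]; below weight zero
     nothing is left. *)
  have [n] : exists n : nat, t < n%:R * weight w F.
    exists (Num.bound (`|t| / weight w F)).
    rewrite -ltr_pdivrMr //; apply: le_lt_trans (archi_boundP _).
      by rewrite ler_pM2r ?invr_gt0 // ler_norm.
    by rewrite divr_ge0 // ltW.
  elim: n t g JgG => [|n IHn] t g JgG lt_t.
    by rewrite weight_part_neg ?(lt_le_trans lt_t) ?mul0r //; case: JI.
  have JtG : J (weight_part w t g * G).
    by rewrite -[t](addrK (weight w G)) -weight_part_mul //; apply: Jgr.
  have [c /(Jgr t)] := regG _ (sub_adjoin F JtG).
  rewrite linearB /= weight_part_mul // weight_part_id; set c' := weight_part _ _ c => Jt.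
  have Jc' : J c'.
    rewrite /c' -weight_part_id -/c'; apply: (IHn); last first.
      by rewrite ltrBlDr -[X in _ + X]mul1r -mulrDl natr1.
    apply: regF; have -> : c' * G * F
        = weight_part w t g * G - G * (weight_part w t g - c' * F) by ring.
    by apply: ideal_sub => //; case: JI => _ _; apply.
  rewrite -(subrK (c' * F) (weight_part w t g)); case: JI => _ JD JM.
  by apply: (JD) => //; rewrite mulrC; apply: JM.
split=> // g [c JgF]; have [_ JD JM] := JI.
have [e Jc] : adjoin J F c.
  apply: regG; exists g; have -> : c * G - g * F = - 1 * (g * F - c * G) by ring.
  exact: JM.
exists e; apply: regF.
have -> : (g - e * G) * F = (g * F - c * G) + G * (c - e * F) by ring.
by apply: (JD) => //; apply: JM.
Qed.

(** By [regular_swap], any element can be moved to the front of the sequence. *)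
Lemma regular_mod_perm J s t : graded_ideal w J ->
  (forall F, F \in s -> weight_homogeneous w F /\ 0 < weight w F) ->
  perm_eq s t -> regular_mod J s -> regular_mod J t.
Proof.
have front J' s1 F s2 : graded_ideal w J' ->
    (forall G, G \in s1 ++ F :: s2 -> weight_homogeneous w G /\ 0 < weight w G) ->
    regular_mod J' (s1 ++ F :: s2) -> regular_mod J' (F :: s1 ++ s2).
  elim: s1 J' => [|G s1 IHs] J' gr hom //= [regG regs].
  have [homG G_gt0] : weight_homogeneous w G /\ 0 < weight w G.
    by apply: hom; rewrite inE eqxx.
  have [homF _] : weight_homogeneous w F /\ 0 < weight w F.
    by apply: hom; rewrite inE mem_cat inE eqxx !orbT.
  have [|regF regFs] := IHs _ (adjoin_graded gr homG) _ regs.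
    by move=> H Hs; apply: hom; rewrite inE Hs orbT.
  have [regF' regG'] := regular_swap gr homG G_gt0 homF regG regF.
  by split=> //; split=> //; rewrite adjoinC.
elim: t s J => [|F t IHt] s J gr hom st; first by rewrite (perm_nilP st).
have Fs : F \in s by rewrite (perm_mem st) inE eqxx.
case/splitPr: Fs st hom => s1 s2 st hom reg.
have {reg} [regF regs] := front _ _ _ _ gr hom reg.
split=> //; apply: IHt regs.
- by apply: adjoin_graded => //; case: (hom F); rewrite // mem_cat inE eqxx orbT.
- by move=> G Gs; apply: hom; move: Gs; rewrite !mem_cat inE => /orP[] ->; rewrite ?orbT.
- by move: st; rewrite perm_catC /= perm_cons perm_catC.
Qed.

Lemma zero_graded : graded_ideal w [set 0 : {mpoly K[r]}].
Proof.
split; last by move=> t F -> /=; rewrite linear0.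
by split=> [|f g -> ->|c f ->] //=; rewrite ?addr0 ?mulr0.
Qed.

Lemma weight_ge0 F : 0 <= weight w F.
Proof. exact: mnm_weight_ge0. Qed.

(** A homogeneous polynomial of weight zero is a constant, either zero, which is
    not regular, or a unit, which generates the whole ring. *)
Lemma regular_weight_gt0 (s : seq {mpoly K[r]}) F :
  regular_sequence s -> F \in s -> weight_homogeneous w F -> 0 < weight w F.
Proof.
move=> [s1 reg] Fs homF; rewrite lt_def weight_ge0 andbT.
apply/eqP=> F0; move: homF; rewrite /weight_homogeneous F0 weight_part0 => FE.
have [_ _ sM] := ideal_gen_ideal [set` s].
have [c0|c_neq0] := eqVneq (F@_0%MM) 0.
  apply: s1; have iF : (index F s < size s)%N by rewrite index_mem.
  have tF : ideal_gen [set` take (index F s) s] (1 * F).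
    by rewrite mul1r -[X in ideal_gen _ X]FE c0; case: (ideal_gen_ideal [set` take (index F s) s]).
  have := reg _ iF 1; rewrite nth_index // => /(_ tF).
  by apply: ideal_gen_le => G /mem_take.
apply: s1; have -> : 1 = (F@_0%MM)^-1%:MP * F.
  by rewrite -{2}FE -mpolyCM mulVf // mpolyC1.
by apply/sM/sub_ideal_gen.
Qed.

(** A coefficient without constant term has positive weight in each of its terms,
    so the generator that it multiplies has weight smaller than [t]. *)
Lemma weight_part_maximal_mul (s : seq {mpoly K[r]}) t F G :
  (forall H, H \in s -> weight_homogeneous w H) ->
  ideal_gen [set` s] F -> G@_0%MM = 0 ->
  ideal_gen [set H | H \in s /\ weight w H < t] (weight_part w t (G * F)).
Proof.
move=> homs sF G0; set J := ideal_gen _.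
have JI : is_ideal J by apply: ideal_gen_ideal.
have [J0 JD JM] := JI.
have QI : is_ideal [set F | forall G, G@_0%MM = 0 -> J (weight_part w t (G * F))].
  split=> /= [H _|F1 F2 JF1 JF2 H H0|c F1 JF1 H H0].
  - by rewrite mulr0 linear0.
  - by rewrite mulrDr linearD; apply: JD; [apply: JF1|apply: JF2].
  - by rewrite mulrA; apply: JF1; rewrite rmorphM /= H0 mul0r.
apply: (ideal_gen_min QI) sF G G0 => H Hs G G0; rewrite weight_part_mul; last exact: homs.
have [lt_Ht|le_tH] := ltP (weight w H) t; first by apply/JM/sub_ideal_gen.
suff -> : weight_part w (t - weight w H) G = 0 by rewrite mul0r.
move: le_tH; rewrite -subr_le0 le_eqVlt => /predU1P[->|/weight_part_neg->//].
  by rewrite weight_part0 G0 mpolyC0.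
Qed.
End Graded.

(** * Positivity of the class group grading *)

(** Completeness expresses minus the sum of all rays as a nonnegative combination
    of rays, that is, gives a relation among the rays all of whose coefficients
    are at least [1]. *)
Lemma complete_fan_weights (R : realType) (r n : nat) (phi : 'M[int]_(r, n))
    (Sigma : {set {set 'I_r}}) : complete_fan R phi Sigma ->
  exists2 w : 'I_r -> R, forall j, 1 <= w j &
    forall k, \sum_j w j * (phi j k)%:~R = 0.
Proof.
case/(_ (- \sum_i ray_gen R phi i)) => J _ [c [c_ge0 xE]].
exists (fun i => 1 + (if i \in J then c i else 0)) => [j|k].
  by rewrite lerDl; case: ifP.
have /matrixP/(_ 0 k) : \sum_i ray_gen R phi i + \sum_(i in J) c i *: ray_gen R phi i = 0.
  by rewrite -xE subrr.
rewrite !mxE !summxE [X in _ + X]big_mkcond -big_split /= => sum0.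
rewrite -[RHS]sum0; apply: eq_bigr => i _.
by rewrite mulrDl mul1r; case: ifP; rewrite !mxE // mul0r.
Qed.

Definition mnm_col (r : nat) (m : 'X_{1..r}) : 'cV[int]_r := \col_j (m j)%:Z.

Lemma cox_degree_sum (r : nat) (A : zmodType) (beta : {additive 'cV[int]_r -> A})
    (m : 'X_{1..r}) :
  \sum_j cox_degree beta j *+ m j = beta (mnm_col m).
Proof.
have -> : mnm_col m = \sum_j delta_mx j 0 *+ m j.
  apply/matrixP=> i k; rewrite summxE (bigD1 i) //= mulmxnE !mxE eqxx ord1 eqxx.
  rewrite big1 ?addr0 ?natz // => j /negbTE ji.
  by rewrite mulmxnE !mxE eq_sym ji mul0rn.
by rewrite raddf_sum; apply: eq_bigr => j _; rewrite raddfMn.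
Qed.

Lemma mnm_col_mul (r : nat) (d : 'I_r -> nat) (m : 'X_{1..r}) :
  mnm_col (mnm_mul d m) = diag_mx (\row_i (d i)%:Z) *m mnm_col m.
Proof. by apply/matrixP=> i j; rewrite mul_diag_mx !mxE mnmE PoszM. Qed.

Lemma cox_degree_mul_sum (r : nat) (A : zmodType) (beta : {additive 'cV[int]_r -> A})
    (d : 'I_r -> nat) (m : 'X_{1..r}) :
  \sum_j (cox_degree beta j *+ d j) *+ m j = beta (mnm_col (mnm_mul d m)).
Proof.
by rewrite -cox_degree_sum; apply: eq_bigr => j _; rewrite mnmE mulrnA.
Qed.

Lemma homogeneous_subst_pow (K : fieldType) (r : nat) (A : zmodType)
    (beta : {additive 'cV[int]_r -> A}) (d : 'I_r -> nat) (F : {mpoly K[r]}) :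
  homogeneous (fun j => cox_degree beta j *+ d j) F ->
  homogeneous (cox_degree beta) (subst_pow d F).
Proof.
case=> alpha Falpha; exists alpha => m /msupp_subst_pow[k kF ->].
by rewrite cox_degree_sum -cox_degree_mul_sum Falpha.
Qed.

Lemma homogeneous_residue_part0 (K : fieldType) (r : nat) (A : zmodType)
    (beta : {additive 'cV[int]_r -> A}) (d : 'I_r -> nat) (F : {mpoly K[r]}) :
  (forall i, 0 < d i)%N -> homogeneous (cox_degree beta) F ->
  homogeneous (fun j => cox_degree beta j *+ d j) (residue_part d 0%MM F).
Proof.
move=> d_gt0 [alpha Falpha]; exists alpha => m.
rewrite mcoeff_msupp mcoeff_residue_part0 // -mcoeff_msupp => /Falpha.
by rewrite cox_degree_sum -cox_degree_mul_sum.
Qed.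

(** The exponents of a homogeneous polynomial differ by elements of the image of
    [phi], which the relation [w] between the rays kills. *)
Lemma homogeneous_weight (R : realType) (K : fieldType) (r n : nat)
    (phi : 'M[int]_(r, n)) (A : zmodType) (beta : {additive 'cV[int]_r -> A})
    (w : 'I_r -> R) (F : {mpoly K[r]}) :
  short_exact phi beta -> (forall k, \sum_j w j * (phi j k)%:~R = 0) ->
  homogeneous (cox_degree beta) F -> weight_homogeneous w F.
Proof.
case=> _ beta0 _ w0 [alpha Falpha].
have eq_weight m k : beta (mnm_col m) = beta (mnm_col k) -> mnm_weight w m = mnm_weight w k.
  move/eqP; rewrite -subr_eq0 -raddfB => /eqP/beta0[u mkE].
  apply/eqP; rewrite -subr_eq0 -sumrB; apply/eqP.
  have mk_j j : w j * (m j)%:R - w j * (k j)%:R = \sum_i w j * ((phi j i)%:~R * (u i 0)%:~R).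
    have := congr1 (fun M : 'cV_r => (M j 0)%:~R : R) mkE; rewrite !mxE rmorphB /= => kE.
    rewrite -mulrBr kE rmorph_sum mulr_sumr; apply: eq_bigr => i _.
    by rewrite rmorphM.
  rewrite (eq_bigr _ (fun j _ => mk_j j)) exchange_big big1 // => i _ /=.
  by under eq_bigr do rewrite mulrA; rewrite -mulr_suml w0 mul0r.
have [->|[k kF]] : F = 0 \/ exists k, k \in msupp F.
- case: (msupp F =P [::]) => [/eqP|]; first by rewrite msupp_eq0 => /eqP; left.
  by case: (msupp F) => // k s _; right; exists k; rewrite inE eqxx.
- by rewrite /weight_homogeneous linear0.
apply: (@weight_homogeneousP _ _ _ _ (mnm_weight w k)) => m mF; apply: eq_weight.
by rewrite -!cox_degree_sum !Falpha.
Qed.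

(** * The vanishing ideal as an extension of the lattice ideal *)

(** The lattice ideal is generated by binomials with coprime terms; a common
    monomial factor can be restored. *)
Lemma lattice_ideal_binomial (K : fieldType) (r : nat) (A : zmodType)
    (beta : {additive 'cV[int]_r -> A}) (d : 'I_r -> nat) (a b : 'X_{1..r}) :
  beta (mnm_col (mnm_mul d a)) = beta (mnm_col (mnm_mul d b)) ->
  lattice_ideal (K := K) (L_betaD beta d) ('X_[a] - 'X_[b]).
Proof.
move=> ab; pose m := mnm_col a - mnm_col b.
pose c : 'X_{1..r} := [multinom minn (a i) (b i) | i < r].
have absz_maxB (x y : nat) : absz (Num.max (x%:Z - y%:Z) 0) = (x - y)%N.
  by case: leP; lia.
have aE : a = (c + pos_part m)%MM.
  by apply/mnmP=> i; rewrite /m !mnmE !mxE absz_maxB; lia.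
have bE : b = (c + neg_part m)%MM.
  by apply/mnmP=> i; rewrite /m !mnmE !mxE opprB absz_maxB; lia.
rewrite aE bE !mpolyXD -mulrBr.
have [_ _ LM] := ideal_gen_ideal
  [set 'X_[K, pos_part m] - 'X_[K, neg_part m] | m in L_betaD beta d].
apply/LM/sub_ideal_gen; exists m => //.
by rewrite /L_betaD /= mulmxBr raddfB /= -!mnm_col_mul ab subrr.
Qed.

Lemma mnm_col_pos_neg (r : nat) (m : 'cV[int]_r) :
  mnm_col (pos_part m) - mnm_col (neg_part m) = m.
Proof.
apply/matrixP=> i j; rewrite !mxE !mnmE ord1.
by move: (m i 0) => z; case: (leP z 0); case: (leP (- z) 0); lia.
Qed.

(** The quotient of the two monomials is a Laurent monomial in the coordinates of
    [torus_map phi g], which are all [1]. *)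
Lemma torus_kernel_monomial (K : fieldType) (r n : nat) (phi : 'M[int]_(r, n))
    (g : 'I_r -> K) (a b : 'X_{1..r}) (u : 'cV[int]_n) :
  torus_kernel phi g -> mnm_col a - mnm_col b = phi *m u ->
  \prod_i g i ^+ a i = \prod_i g i ^+ b i.
Proof.
case=> g_neq0 g1 abE.
have prod1 : \prod_i g i ^ ((phi *m u) i 0) = 1.
  transitivity (\prod_i \prod_j (g i ^ phi i j) ^ u j 0).
    apply: eq_bigr => i _; rewrite mxE.
    rewrite (big_morph (fun z => g i ^ z) (fun x y => expfzDr x y (g_neq0 i)) (expr0z _)).
    by apply: eq_bigr => j _; rewrite exprz_exp.
  rewrite exchange_big big1 // => j _.
  transitivity (torus_map phi g j ^ u j 0); last by rewrite g1 exp1rz.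
  by rewrite /torus_map (big_morph (fun x : K => x ^ u j 0) (fun x y => expfzMl x y _) (exp1rz _ _)).
transitivity (\prod_i (g i ^+ b i * g i ^ ((phi *m u) i 0))); last first.
  by rewrite big_split /= prod1 mulr1.
apply: eq_bigr => i _; rewrite -abE !mxE !exprnP -expfzDr ?g_neq0 //.
by rewrite subrKC.
Qed.

Section CyclicSubmonoid.
Context (K : fieldType) (n r : nat) (phi : 'M[int]_(r, n)) (A : zmodType)
        (beta : {additive 'cV[int]_r -> A}) (exact_beta : short_exact phi beta)
        (eta : K) (a : 'I_r -> int) (d : 'I_r -> nat)
        (order_d : forall i, (d i).-primitive_root (eta ^ a i)).

Let d_gt0 i : (0 < d i)%N.
Proof. exact: prim_order_gt0 (order_d i). Qed.

Let IL := lattice_ideal (K := K) (L_betaD beta d).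
Let Y := Y_AH phi a (cyclic_submonoid eta).

(** On [Y] the powers [x_i ^ d_i] are coordinates of an element of [G], on which
    the monomial depends only through the degree of its exponent. *)
Lemma vanishing_binomial (e f : 'X_{1..r}) :
  beta (mnm_col (mnm_mul d e)) = beta (mnm_col (mnm_mul d f)) ->
  homogeneous (cox_degree beta) ('X_[K, mnm_mul d e] - 'X_[mnm_mul d f]) /\
  vanishes_on ('X_[K, mnm_mul d e] - 'X_[mnm_mul d f]) Y.
Proof.
move=> ef; split.
  exists (beta (mnm_col (mnm_mul d e))) => m /msuppB_le.
  by rewrite mem_cat !msuppX !inE cox_degree_sum => /orP[] /eqP->.
move=> _ [t tH <-] _ [g gG <-].
have [_ beta0 _] := exact_beta.
have /beta0[u efE] : beta (mnm_col (mnm_mul d e) - mnm_col (mnm_mul d f)) = 0.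
  by rewrite raddfB /= ef subrr.
have t1 i : (t i ^ a i) ^+ d i = 1.
  have [k _ <-] := tH i.
  have -> : (eta ^+ k) ^ a i = (eta ^ a i) ^+ k by rewrite !exprnP exprzAC.
  by rewrite exprAC (prim_expr_order (order_d i)) expr1n.
have evalE h : 'X_[mnm_mul d h].@[fun i => g i * t i ^ a i] = \prod_i g i ^+ (mnm_mul d h i).
  by rewrite mevalX; apply: eq_bigr => i _; rewrite exprMn mnmE [in X in _ * X]exprM t1 expr1n mulr1.
by rewrite mevalB !evalE (torus_kernel_monomial gG efE) subrr.
Qed.

(** The points of [Y] coming from [t_i = eta ^ k_i], with the identity of [G] as
    the representative, fill the grid of [d_i]-th roots of unity. *)
Lemma vanishing_grid F : vanishes_on F Y ->
  forall k : 'I_r -> nat, F.@[fun i => (eta ^ a i) ^+ k i] = 0.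
Proof.
move=> F0 k.
pose t i := eta ^+ k i.
apply: (F0 (orbit_class phi (fun i => t i ^ a i))).
  by exists t => //= i; exists (k i).
exists (fun=> 1).
  split=> [i|j]; first exact: oner_neq0.
  by rewrite /torus_map big1 // => i _; rewrite exp1rz.
by apply/funext => i; rewrite mul1r /t !exprnP exprzAC.
Qed.

(** Fourier inversion on the group of [d]-th roots of unity: the characters given
    by monomials of different residue classes are orthogonal. *)
Lemma residue_class_sum F (c : 'X_{1..r}) : vanishes_on F Y ->
  \sum_(m <- msupp F | mnm_mod d m == mnm_mod d c) F@_m = 0.
Proof.
move=> /vanishing_grid F0.
(* A common multiple of the orders, invertible in [K], so that all coordinates
   of the grid can be indexed by the same range. *)
pose N := (\prod_i d i)%N; pose z i := eta ^ a i.
have dN i : (d i %| N)%N by rewrite /N (bigD1 i) //= dvdn_mulr.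
have N_neq0 : N%:R != 0 :> K.
  rewrite natr_prod; apply/prodf_neq0 => i _.
  exact: prim_root_natf_neq0 (order_d i).
have z_neq0 i : z i != 0.
  apply/eqP => z0; have := prim_expr_order (order_d i); rewrite -/(z i) z0.
  by rewrite expr0n gtn_eqF // => /eqP; rewrite eq_sym oner_eq0.
have geom i (m : 'X_{1..r}) : \sum_(k < N) (z i ^+ m i / z i ^+ c i) ^+ k =
    if (m i %% d i == c i %% d i)%N then N%:R else 0.
  set y := _ / _; have yN : y ^+ N = 1.
    have zN j : (z i ^+ j) ^+ N = 1.
      by rewrite exprAC -(prim_expr_mod (order_d i)) (eqP (dN i)) expr0 expr1n.
    by rewrite expr_div_n !zN divr1.
  rewrite -(eq_prim_root_expr (order_d i)) -/(z i).
  case: eqP => [zE|z_neq].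
    rewrite /y zE divff ?expf_neq0 //.
    by under eq_bigr do rewrite expr1n; rewrite sumr_const card_ord.
  apply/eqP; have /eqP := subrX1 y N; rewrite yN subrr eq_sym mulf_eq0 subr_eq0.
  by case/orP=> // /eqP y1; case: z_neq; rewrite -[LHS](divfK (expf_neq0 (c i) (z_neq0 i))) -/y y1 mul1r.
have : \sum_(k : {ffun 'I_r -> 'I_N})
    (\prod_i (z i ^+ c i)^-1 ^+ k i) * F.@[fun i => z i ^+ k i] = 0.
  by rewrite big1 // => k _; rewrite F0 mulr0.
under eq_bigr do rewrite mevalE mulr_sumr.
rewrite exchange_big /=.
(* The sum over [k] factors into geometric sums, one for each variable. *)
rewrite (eq_bigr (fun m => F@_m * (if mnm_mod d m == mnm_mod d c then N%:R ^+ r else 0))).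
  move=> sum0; apply: (mulIf (expf_neq0 r N_neq0)); rewrite mul0r -[RHS]sum0.
  by rewrite [in LHS]big_mkcond mulr_suml; apply: eq_bigr => m _; case: ifP; rewrite ?mulr0 ?mul0r.
move=> m _; transitivity (F@_m * \prod_i \sum_(k < N) (z i ^+ m i / z i ^+ c i) ^+ k).
  rewrite bigA_distr_bigA mulr_sumr; apply: eq_bigr => k _ /=.
  rewrite mulrCA -big_split; congr (_ * _); apply: eq_bigr => i _ /=.
  by rewrite exprMn mulrC -!exprM mulnC.
congr (_ * _); under eq_bigr do rewrite geom.
case: eqP => [/mnmP mc|mc].
  rewrite (eq_bigr (fun=> N%:R)) ?prodr_const ?card_ord // => i _.
  by have := mc i; rewrite !mnmE => ->; rewrite eqxx.
apply/eqP/prodf_eq0; case: (pickP (fun i => m i %% d i != c i %% d i)%N) => [i mi|mi].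
  by exists i; rewrite // (negbTE mi).
by case: mc; apply/mnmP=> i; rewrite !mnmE; have /negbFE/eqP := mi i.
Qed.

(** Within a residue class the exponents of a homogeneous [F] differ by [d] times
    an element of the lattice, and the coefficients add up to zero. *)
Lemma residue_part_lattice F (c : 'X_{1..r}) :
  homogeneous (cox_degree beta) F -> vanishes_on F Y -> IL (residue_part d c F).
Proof.
move=> [alpha Falpha] F0.
have ILI : is_ideal IL := ideal_gen_ideal _.
have [IL0 ILD ILM] := ILI.
have [/hasP[m0 m0F /eqP m0c]|/hasPn no_c] := boolP (has (fun m => mnm_mod d m == c) (msupp F)); last first.
  rewrite /residue_part /monomial_linear big_seq big1 // => m /no_c/negbTE ->.
  exact: scaler0.
have -> : residue_part d c F = \sum_(m <- msupp F | (m \in msupp F) && (mnm_mod d m == c))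
    (F@_m)%:MP * ('X_[mnm_div d m] - 'X_[mnm_div d m0]).
  rewrite -big_seq_cond.
  under [RHS]eq_bigr do rewrite mul_mpolyC scalerBr.
  rewrite sumrB -scaler_suml -m0c residue_class_sum // scale0r subr0 big_mkcond.
  by apply: eq_bigr => m _; case: ifP; rewrite ?scaler0.
apply: ideal_sum => // m /andP[mF /eqP mc]; apply/ILM/lattice_ideal_binomial.
have degE k : mnm_mod d k = c ->
    beta (mnm_col (mnm_mul d (mnm_div d k))) = beta (mnm_col k) - beta (mnm_col c).
  move=> kc; rewrite -raddfB; congr (beta _); apply/matrixP=> i j.
  by rewrite -kc !mxE !mnmE {2}(divn_eq (k i) (d i)) mulnC PoszD addrK.
by rewrite !degE //; congr (_ - _); rewrite -!cox_degree_sum !Falpha.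
Qed.

(** Both inclusions are checked on generators: membership of a homogeneous
    vanishing polynomial is tested on its residue parts, and the extension is
    generated by the images of the lattice binomials. *)
Lemma vanishing_ideal_extension :
  vanishing_ideal (cox_degree beta) Y = ideal_gen (@subst_pow K r d @` IL).
Proof.
have proj := subst_pow_projective K d_gt0.
apply/seteqP; split.
  apply: ideal_gen_min => [|F [homF F0]]; first exact: ideal_gen_ideal.
  rewrite (extended_ideal_coord proj) => c; apply: sub_ideal_gen.
  exact: residue_part_lattice.
rewrite (extension_gen proj); apply: ideal_gen_le => _ [_ [m Lm <-] <-].
rewrite rmorphB /= !subst_powX; apply: vanishing_binomial.
apply/eqP; rewrite -subr_eq0 -raddfB /= !mnm_col_mul -mulmxBr mnm_col_pos_neg.
exact/eqP.
Qed.
End CyclicSubmonoid.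

(** * Descent of regular sequences *)

Lemma weight_part_residue_part0 (R : realType) (K : fieldType) (r : nat)
    (w : 'I_r -> R) (d : 'I_r -> nat) t (F : {mpoly K[r]}) :
  weight_part w t F = F ->
  weight_part w t (subst_pow d (residue_part d 0%MM F)) = subst_pow d (residue_part d 0%MM F).
Proof.
move=> <-; elim/mpolyind: F => [|a m F _ _ IHF]; first by rewrite !linear0.
rewrite !linearD /= IHF !linearZ /=; congr (_ *: _ + _).
rewrite weight_partX; case: eqP => [mt|_]; last by rewrite !linear0.
rewrite residue_partX; case: eqP => [m0|_]; last by rewrite !linear0.
by rewrite subst_powX -[mnm_mul _ _]add0m -m0 -mnm_divE weight_partX mt eqxx.
Qed.

Lemma mcoeff0_mpolyX (r : nat) (m : 'X_{1..r}) (K : fieldType) :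
  m != 0%MM -> ('X_[K, m])@_0%MM = 0.
Proof. by rewrite mcoeffX => /negbTE->. Qed.

(** Sort [s] by weight and replace each [F] by the part of [F] with exponents
    divisible by [d]. The rest of [F] is in the maximal ideal times the extension
    of [J], hence a combination of elements of [s] of smaller weight. *)
Lemma regular_sequence_descent (R : realType) (K : fieldType) (r : nat)
    (w : 'I_r -> R) (d : 'I_r -> nat) (J : set {mpoly K[r]}) (s : seq {mpoly K[r]}) :
  (forall j, 1 <= w j) -> (forall i, 0 < d i)%N -> is_ideal J ->
  (forall F, F \in s -> weight_homogeneous w F) ->
  regular_sequence s -> ideal_gen [set` s] = ideal_gen (@subst_pow K r d @` J) ->
  exists2 s', perm_eq s s' &
    regular_sequence (map (residue_part d 0%MM) s') /\
    ideal_gen [set` map (residue_part d 0%MM) s'] = J.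
Proof.
move=> w_ge1 d_gt0 JI homs reg sJ; have proj := subst_pow_projective K d_gt0.
pose s' := sort (relpre (weight w) <=%O) s.
have ss' : perm_eq s s' by rewrite perm_sym perm_sort.
have set_s' : [set` s'] = [set` s].
  by apply/seteqP; split=> F /=; rewrite (perm_mem ss').
have homs' F : F \in s' -> weight_homogeneous w F by rewrite -(perm_mem ss'); apply: homs.
exists s' => //; set f := residue_part d 0%MM.
pose g F : {mpoly K[r]} := subst_pow d (f F).
have [s1 reg0] := (regular_sequenceE s).1 reg.
have {reg0} reg' : regular_mod [set 0] s'.
  apply: (regular_mod_perm w_ge1 (zero_graded K w) _ ss' reg0) => F Fs.
  have homF := homs F Fs; split=> //.
  exact: (regular_weight_gt0 w_ge1 reg Fs homF).
have sorted_s' : pairwise (relpre (weight w) <=%O) s'.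
  have w_trans : transitive (relpre (weight w : {mpoly K[r]} -> R) <=%O).
    by move=> F G H /=; apply: le_trans.
  by rewrite -(sorted_pairwise w_trans); apply: sort_sorted => F G /=; apply: le_total.
have tri p F q : s' = p ++ F :: q -> foldl (@adjoin _) [set 0] p (F - g F).
  move=> s'E; rewrite foldl_adjoin_gen.
  have Fs' : F \in s' by rewrite s'E mem_cat inE eqxx orbT.
  have below : [set H | H \in s' /\ weight w H < weight w F] `<=` [set` p].
    move=> H [/=]; rewrite s'E mem_cat => /orP[//|].
    have := sorted_s'; rewrite s'E pairwise_cat pairwise_cons => /and3P[_ _ /andP[/allP Fq _]].
    by rewrite inE => /predU1P[->|/Fq /= leFH]; rewrite ltNge ?lexx ?leFH.
  have -> : F - g F = weight_part w (weight w F) (F - g F).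
    by rewrite linearB /= weight_part_residue_part0 homs'.
  apply: (ideal_gen_le below).
  have -> : F - g F = \sum_(c : 'X_{1..r < (\sum_i d i).+1}
      | c != BMultinom (mdeg0_bound r (\sum_i d i))) 'X_[c] * subst_pow d (residue_part d c F).
    rewrite {1}(residue_part_sum d_gt0 F).
    rewrite (bigD1 (BMultinom (mdeg0_bound r (\sum_i d i)))) //= mpolyX0 mul1r.
    by rewrite addrAC subrr add0r.
  rewrite linear_sum; apply: ideal_sum; first exact: ideal_gen_ideal.
  move=> c c_neq0; apply: weight_part_maximal_mul => //; last first.
    apply: mcoeff0_mpolyX; apply: contra c_neq0 => /eqP c0.
    exact/eqP/val_inj.
  rewrite set_s' sJ (contracted_extension proj).
  have /(extended_ideal_coord proj) : ideal_gen (@subst_pow K r d @` J) F.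
    by rewrite -sJ; apply: sub_ideal_gen; rewrite /= (perm_mem ss').
  exact.
have zI : is_ideal [set 0 : {mpoly K[r]}] by case: (zero_graded K w).
have [regg foldg] := regular_mod_map_triangular zI tri reg'.
rewrite !foldl_adjoin_gen set_s' in foldg.
have gE : map g s' = map (@subst_pow K r d) (map f s') by rewrite -map_comp.
split.
  rewrite (regular_sequence_extension proj) -gE regular_sequenceE; split=> //.
  by rewrite foldg.
rewrite gE set_map_image sJ in foldg.
apply/seteqP; split=> F; rewrite -(contracted_extension proj) foldg.
  by rewrite (contracted_extension proj) ideal_gen_id.
by move=> JF; apply: sub_ideal_gen; exists F.
Qed.

Theorem proposition4p12
  (R : realType) (K : fieldType) (n r : nat)
  (phi : 'M[int]_(r, n)) (Sigma : {set {set 'I_r}})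
  (fan_Sigma : is_fan R phi Sigma)
  (simplicial_Sigma : simplicial_fan R phi Sigma)
  (complete_Sigma : complete_fan R phi Sigma)
  (A : zmodType) (beta : {additive 'cV[int]_r -> A})
  (exact_beta : short_exact phi beta)
  (exact_pi : set_surj (torus (K := K) (r := r)) (torus (K := K) (r := n))
                (torus_map phi))
  (tau : nat) (card_torsion : (torsion_part (A := A) #= `I_tau)%card)
  (coprime_torsion : forall p : nat, p \in [pchar K] -> coprime tau p)
  (eta : K) (eta_neq0 : eta != 0)
  (finite_H : finite_set (cyclic_submonoid eta))
  (a : 'I_r -> int) (d : 'I_r -> nat)
  (order_d : forall i, (d i).-primitive_root (eta ^ a i)) :
  let degS := cox_degree beta in
  let degL := fun j : 'I_r => degS j *+ d j in
  let IY := vanishing_ideal degS (Y_AH phi a (cyclic_submonoid eta)) in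
  let IL := lattice_ideal (K := K) (L_betaD beta d) in
  [/\ (forall B : set {mpoly K[r]},
         (forall F, B F -> is_binomial F) -> generating_system IL B ->
         (forall F, (subst_pow d @` B) F -> is_binomial F) /\
         generating_system IY (subst_pow d @` B)),
      complete_intersection degS IY <-> complete_intersection degL IL
    & complete_intersection degS IY ->
      forall B : set {mpoly K[r]}, minimal_generating_system IL B ->
        minimal_generating_system IY (subst_pow d @` B) /\
        ((forall F, B F -> homogeneous degL F) ->
         forall F, (subst_pow d @` B) F -> homogeneous degS F)].

Proof.
move=> degS degL IY IL.
have d_gt0 i : (0 < d i)%N by exact: prim_order_gt0 (order_d i).
have proj := subst_pow_projective K d_gt0.
have ILI : is_ideal IL := ideal_gen_ideal _.
have IYE : IY = ideal_gen (@subst_pow K r d @` IL).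
  exact: vanishing_ideal_extension.
have gen_ext B : generating_system IL B <-> generating_system IY (subst_pow d @` B).
  rewrite /generating_system IYE; split=> [<-|BE].
    by rewrite (extension_gen proj).
  apply/seteqP; split=> F; rewrite -(contracted_extension proj) BE.
    by rewrite (contracted_extension proj) ideal_gen_id.
  by move=> ILF; apply: sub_ideal_gen; exists F.
have height_ext k : ideal_height IL k <-> ideal_height IY k.
  by rewrite IYE; apply: (ideal_height_extension proj); apply: subst_pow_integral.
split.
- move=> B binB /gen_ext genB; split=> // _ [F /binB[m [k ->]] <-].
  by exists (mnm_mul d m), (mnm_mul d k); rewrite rmorphB /= !subst_powX.
- have [w w_ge1 w0] := complete_fan_weights complete_Sigma.
  split=> -[s [homs reg gens hts]].
    have [||s' ss' [reg' gens']] := regular_sequence_descent w_ge1 d_gt0 ILI _ reg _.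
    + by move=> F /homs; apply: homogeneous_weight w0.
    + by rewrite -IYE.
    exists (map (residue_part d 0%MM) s'); split=> //.
      move=> _ /mapP[F Fs' ->]; apply: homogeneous_residue_part0 => //.
      by apply: homs; rewrite (perm_mem ss').
    by rewrite size_map -(perm_size ss'); apply/height_ext.
  exists (map (@subst_pow K r d) s); split.
  + by move=> _ /mapP[F /homs homF ->]; apply: homogeneous_subst_pow.
  + exact: (regular_sequence_extension proj s).1 reg.
  + by rewrite set_map_image; apply/gen_ext.
  + by rewrite size_map; apply/height_ext.
- move=> _ B [/gen_ext genB minB]; split.
    split=> // G [leG ltG] genG.
    (* Generators in the image descend, so a smaller [G] comes from a smaller [B]. *)
    have GE : G = subst_pow d @` (B `&` subst_pow d @^-1` G).
      apply/seteqP; split=> [F GF|_ [F [_ GF] <-] //].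
      by have [H BH HF] := leG F GF; exists H => //; split=> //=; rewrite HF.
    apply: (minB (B `&` subst_pow d @^-1` G)); last by apply/gen_ext; rewrite -GE.
    split; first by move=> F [].
    by move=> leB; apply: ltG => _ [F /leB[_ GF] <-].
  by move=> homB _ [F /homB homF <-]; apply: homogeneous_subst_pow.
Qed.
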